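(* Let $(T,d)$ be a finite metric tree. Then for all natural numbers $n\ge 2$, all finite subsets $\{x_1,\dots,x_n\}\subseteq T$, and all choices of real numbers $\eta_1,\dots,\eta_n$ with $\eta_1+\cdots+\eta_n=0$, we have $$\frac{\Gamma_T}{2}\Bigl(\sum_{\ell=1}^{n}|\eta_\ell|\Bigr)^2+\sum_{1\le i,j\le n} d(x_i,x_j)\,\eta_i\eta_j\ \le\ 0,$$ where $\Gamma_T=\Bigl\{\sum_{e\in E(T)}|e|^{-1}\Bigr\}^{-1}$.
   Context: A finite metric tree $(T,d)$ is a finite connected graph $T$ without cycles (identified with its vertex set), each edge carrying a positive weight, where $d(x,y)$ is the sum of the weights of the edges on the unique path from $x$ to $y$. $E(T)$ is the set of edges and $|e|=d(x,y)$ for an edge $e=(x,y)$. In a finite subset $\{x_1,\dots,x_n\}$ the points $x_1,\dots,x_n$ are pairwise distinct. *)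

(* Defs.v *)
From HB Require Import structures.
From mathcomp Require Import all_boot all_order all_algebra.
From mathcomp Require Import reals.

Set Implicit Arguments.
Unset Strict Implicit.
Unset Printing Implicit Defensive.

Import Order.TTheory GRing.Theory Num.Theory.

Local Open Scope ring_scope.

(* The edge joining x and y is the two-element set [set x; y]; only the values
   of weight on such sets are meaningful. *)
Record metricTree (R : realType) := MetricTree {
  vertex :> finType;
  adj : rel vertex;
  weight : {set vertex} -> R;
  adj_sym : symmetric adj;
  adj_irr : irreflexive adj;
  adj_connected : forall x y, connect adj x y;
  adj_acyclic : forall c : seq vertex, (2 < size c)%N -> ~ ucycle adj c;
  weight_gt0 : forall x y, adj x y -> 0 < weight [set x; y]
}.

Arguments adj {R} _.
Arguments weight {R} _.

Definition simple_path (T : finType) (e : rel T) (x y : T) (p : seq T) : bool :=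
  [&& path e x p, last x p == y & uniq (x :: p)].

Section SimplePath.

Variables (T : finType) (e : rel T).
Hypothesis e_sym : symmetric e.
Hypothesis e_acyclic : forall c : seq T, (2 < size c)%N -> ~ ucycle e c.

Lemma simple_path_fork (x y a b : T) (p q : seq T) :
  simple_path e x y (a :: p) -> simple_path e x y (b :: q) -> a = b.
Proof.
move=> /and3P[ep /eqP lp up] /and3P[eq /eqP lq uq].
apply/eqP/negPn/negP => nab.
have [p1 [z [p2 [Ep zq disj]]]] : exists p1 z p2,
    [/\ a :: p = p1 ++ z :: p2, z \in b :: q & ~~ has (mem (b :: q)) p1].
  have hs : has (mem (b :: q)) (a :: p).
    apply/hasP; exists y; first by rewrite -lp; exact: (mem_last a p).
    by rewrite -lq; exact: (mem_last b q).
  case/split_find: hs => z p1 p2 zq disj; exists p1, z, p2.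
  by rewrite cat_rcons.
have [q1 [q2 Eq]] : exists q1 q2, b :: q = q1 ++ z :: q2.
  by case/splitPr: zq => q1 q2; exists q1, q2.
have sz : (0 < size p1 + size q1)%N.
  case: p1 q1 Ep Eq {disj} => [|? ?] [|? ?] // [ea _] [eb _].
  by rewrite ea eb eqxx in nab.
move: disj ep up eq uq; rewrite Ep Eq => disj.
rewrite -!cat_rcons !cat_path.
move=> /andP[ep1 _] up /andP[eq1 _] uq.
have {}up : uniq (x :: rcons p1 z).
  by move: up; rewrite -cat_cons cat_uniq => /andP[].
have {}uq : uniq (x :: rcons q1 z).
  by move: uq; rewrite -cat_cons cat_uniq => /andP[].
apply: (@e_acyclic (x :: rcons p1 z ++ rev q1)).
  by rewrite /= size_cat size_rcons size_rev addSn !ltnS.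
apply/andP; split.
  rewrite /= rcons_cat cat_path ep1 last_rcons /= -rev_cons.
  have := rev_path e x (rcons q1 z).
  rewrite last_rcons belast_rcons => ->.
  by rewrite (eq_path (e' := e)) // => u v; rewrite e_sym.
rewrite -cat_cons cat_uniq up rev_uniq /=.
move: uq; rewrite /= rcons_uniq mem_rcons inE negb_or.
case/and3P => /andP[nxz nxq1] nzq1 ->; rewrite andbT.
apply/hasPn => u; rewrite mem_rev => uq1.
rewrite /= inE mem_rcons inE !negb_or.
apply/and3P; split.
- by apply: contraNneq nxq1 => <-.
- by apply: contraNneq nzq1 => <-.
- by apply: contra disj => up1; apply/hasP; exists u => //=; rewrite mem_cat uq1.
Qed.

Lemma simple_path_uniq (x y : T) (p q : seq T) :
  simple_path e x y p -> simple_path e x y q -> p = q.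
Proof.
elim: p x q => [|a p IH] x [|b q] //.
- move=> /and3P[_ /eqP /= <- _] /and3P[_ /eqP /= lq /andP[+ _]].
  by rewrite -{1}lq mem_last.
- move=> /and3P[_ /eqP /= lp /andP[+ _]] /and3P[_ /eqP /= xy _].
  by rewrite xy -{1}lp mem_last.
move=> sp sq; have eab := simple_path_fork sp sq; subst b.
congr (_ :: _); apply: (IH a).
  by case/and3P: sp => /= /andP[_ ep] lp /andP[_ up]; apply/and3P.
by case/and3P: sq => /= /andP[_ ep] lp /andP[_ up]; apply/and3P.
Qed.

End SimplePath.

Section MetricTree.

Variables (R : realType) (T : metricTree R).

Definition edges : {set {set T}} :=
  [set [set xy.1; xy.2] | xy : T * T & adj T xy.1 xy.2].

Lemma ex_tree_path (x y : T) : exists p, simple_path (adj T) x y p.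
Proof.
have /connectP[p ep ->] := adj_connected x y.
by case/shortenP: ep => p' ep' up' _; exists p'; apply/and3P; split.
Qed.

(* The vertices following x on the path from x to y. *)
Definition tree_path (x y : T) : seq T := xchoose (ex_tree_path x y).

Fixpoint path_length (x : T) (p : seq T) : R :=
  if p is y :: q then weight T [set x; y] + path_length y q else 0.

Definition tree_dist (x y : T) : R := path_length x (tree_path x y).

Definition Gamma : R := (\sum_(E in edges) (weight T E)^-1)^-1.

Lemma tree_pathP (x y : T) : simple_path (adj T) x y (tree_path x y).
Proof. exact: xchooseP (ex_tree_path x y). Qed.

Lemma tree_path_uniq (x y : T) (p : seq T) :
  simple_path (adj T) x y p -> tree_path x y = p.
Proof.
exact: (simple_path_uniq (@adj_sym R T) (@adj_acyclic R T) (tree_pathP x y)).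
Qed.

Lemma tree_dist_adj (x y : T) :
  adj T x y -> tree_dist x y = weight T [set x; y].
Proof.
move=> exy; rewrite /tree_dist (@tree_path_uniq x y [:: y]) /= ?addr0 //.
rewrite /simple_path /= exy eqxx /= inE andbT.
by apply/eqP => xy; rewrite xy adj_irr in exy.
Qed.

End MetricTree.

Arguments edges {R} T.
Arguments Gamma {R} T.

(* Main.v *)
Require Import Defs.
From mathcomp Require Import all_boot all_order all_algebra.
From mathcomp Require Import reals.
From mathcomp Require Import ring lra.

(** Place mass [mu z] at each vertex [z], with total mass zero.  Across each
    edge [u - v] there is a well-defined net mass [flow mu u v], the total mass
    of the component containing [v] once the edge is cut.  Two facts about this
    flow give the theorem.

    Its divergence at [u] is [- mu u] ([flow_divergence]), because the other
    vertices are distributed among the branches at [u]; hence the total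
    variation of [mu] is at most the sum of [|flow mu u v|] over directed edges.

    The potential [g u = \sum_z tree_dist u z * mu z] changes by
    [2 * weight * flow] along an edge ([potential_drop]), because crossing an
    edge changes the distance to every vertex by exactly the weight of the edge,
    up or down according to the side.  Summation by parts against the
    divergence identity therefore turns the quadratic form of the distance into
    minus the sum of [weight * flow ^+ 2] over directed edges
    ([tree_dist_form]): the energy of the flow.

    It remains to bound the energy below by the square of the l1 norm of the
    flow.  That is the Cauchy-Schwarz inequality with weights, and the constant
    is the sum of the inverse weights, each edge counted in both directions. *)

Set Implicit Arguments.
Unset Strict Implicit.
Unset Printing Implicit Defensive.

Import Order.TTheory GRing.Theory Num.Theory.

Local Open Scope ring_scope.

Lemma set2_eq (T : finType) (a b c d : T) : a != b ->
  ([set c; d] == [set a; b]) = ((c, d) == (a, b)) || ((c, d) == (b, a)).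
Proof.
move=> ab; apply/eqP/orP => [E|[] /eqP [-> ->] //]; last exact: setUC.
have /set2P cab : c \in [set a; b] by rewrite -E set21.
have /set2P dab : d \in [set a; b] by rewrite -E set22.
have := set21 a b; have := set22 a b; rewrite -E !inE.
case: cab dab => -> [] ->; rewrite ?eqxx; auto.
  by rewrite eq_sym (negPf ab).
by rewrite (negPf ab).
Qed.

Section Flow.

Variables (R : realType) (T : metricTree R).
Implicit Types (u v z : T) (mu : T -> R).

(** If [v] lies on the path from [u] to [z], then prefixing [u] to the part of
    that path after [v] is again simple, so uniqueness makes [v] its first step;
    otherwise the path can be prolonged backwards to [v]. *)
Lemma tree_path_step u v z : adj T u v ->
  tree_path u z = v :: tree_path v z \/ tree_path v z = u :: tree_path u z.
Proof.
move=> uv; have /and3P[ep lp up] := tree_pathP u z.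
have [vp|nvp] := boolP (v \in tree_path u z); [left|right]; last first.
  apply: tree_path_uniq; apply/and3P; split.
  - by rewrite /= adj_sym uv.
  - by [].
  - rewrite cons_uniq up andbT inE (negPf nvp) orbF.
    by apply: contraTneq uv => ->; rewrite adj_irr.
have [p2 sp2 nup2] : exists2 p2, simple_path (adj T) v z p2 & u \notin v :: p2.
  case/splitPr: vp ep lp up => p1 p2.
  rewrite cat_path /= last_cat /= => /and3P[_ _ ep2] lp2.
  rewrite mem_cat negb_or cat_uniq => /andP[/andP[_ nup2] /and3P[_ _ up2]].
  by exists p2 => //; apply/and3P.
rewrite (tree_path_uniq sp2); apply: tree_path_uniq.
have /and3P[ep2 lp2 up2] := sp2; apply/and3P; split=> //; first by rewrite /= uv.
by rewrite cons_uniq nup2.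
Qed.

(** For adjacent [u] and [v], this says that cutting the edge [u - v] leaves [z]
    on the side of [v]. *)
Definition toward u v z := tree_path u z == v :: tree_path v z.

Lemma towardC u v z : adj T u v -> toward v u z = ~~ toward u v z.
Proof.
move=> uv; rewrite /toward.
have neq p a b : (p == a :: b :: p :> seq T) = false.
  apply/negP => /eqP/(congr1 size) /= /eqP.
  by rewrite -addn2 -{1}[size p]addn0 eqn_add2l.
by case: (tree_path_step z uv) => ->; rewrite eqxx neq.
Qed.

Lemma tree_path_id u : tree_path u u = [::].
Proof. by apply: tree_path_uniq; rewrite /simple_path /= eqxx. Qed.

(** Every vertex other than [u] lies in exactly one branch at [u], which is
    named by its first vertex. *)
Lemma toward_head u v z : adj T u v ->
  (z != u) && (head u (tree_path u z) == v) = toward u v z.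
Proof.
move=> uv; apply/idP/idP => [|/eqP tuv].
  case/andP=> zu hv; have := tree_path_step z uv.
  rewrite /toward; case=> [->//|vz].
  have /and3P[_ + +] := tree_pathP u z; have /and3P[_ _] := tree_pathP v z.
  rewrite vz; move: hv; case: (tree_path u z) => [|a p] /=.
    by rewrite [u == z]eq_sym (negPf zu).
  by move=> /eqP ->; rewrite !inE eqxx /= orbT.
rewrite tuv eqxx andbT; apply/eqP => zu.
by move: tuv; rewrite zu tree_path_id.
Qed.

Lemma adj_head u z : z != u -> adj T u (head u (tree_path u z)).
Proof.
move=> zu; have /and3P[] := tree_pathP u z.
by case: (tree_path u z) => [|a p] /=; [rewrite eq_sym (negPf zu) | case/andP].
Qed.

Lemma tree_dist_toward u v z : adj T u v ->
  tree_dist u z - tree_dist v z = (-1) ^+ (~~ toward u v z) * weight T [set u; v].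
Proof.
move=> uv; rewrite /tree_dist; case: (boolP (toward u v z)) => [/eqP ->|].
  by rewrite /= expr0 mul1r addrK.
rewrite -towardC // => /eqP -> /=.
by rewrite expr1 mulN1r (setUC [set v]) opprD addrCA subrr addr0.
Qed.

Definition flow mu u v := \sum_(z | toward u v z) mu z.

Lemma flow_antisym mu u v : \sum_z mu z = 0 -> adj T u v ->
  flow mu v u = - flow mu u v.
Proof.
move=> mu0 uv; apply/eqP; rewrite -addr_eq0 addrC; apply/eqP.
apply: etrans mu0; rewrite [RHS](bigID (toward u v)) /=; congr (_ + _).
by apply: eq_bigl => z; rewrite towardC.
Qed.

Lemma flow_divergence mu u : \sum_z mu z = 0 ->
  \sum_(v | adj T u v) flow mu u v = - mu u.
Proof.
move=> mu0; apply: (addIr (mu u)); rewrite addNr.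
apply: etrans mu0; rewrite [RHS](bigD1 u) //= addrC; congr (_ + _); symmetry.
rewrite (partition_big (fun z => head u (tree_path u z)) (adj T u)) /=; last first.
  by move=> z; apply: adj_head.
by apply: eq_bigr => v uv; apply: eq_bigl => z; rewrite toward_head.
Qed.

Lemma potential_drop mu u v : \sum_z mu z = 0 -> adj T u v ->
  \sum_z tree_dist u z * mu z - \sum_z tree_dist v z * mu z =
    2 * (weight T [set u; v] * flow mu u v).
Proof.
move=> mu0 uv; rewrite -sumrB (bigID (toward u v)) /=.
have -> : \sum_(z | toward u v z) (tree_dist u z * mu z - tree_dist v z * mu z)
    = weight T [set u; v] * flow mu u v.
  rewrite mulr_sumr; apply: eq_bigr => z uvz.
  by rewrite -mulrBl tree_dist_toward // uvz mul1r.
have -> : \sum_(z | ~~ toward u v z)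
      (tree_dist u z * mu z - tree_dist v z * mu z)
    = - (weight T [set u; v] * flow mu v u).
  rewrite -mulrN /flow -sumrN mulr_sumr; under [RHS]eq_bigl do rewrite towardC //.
  apply: eq_bigr => z uvz.
  by rewrite -mulrBl tree_dist_toward // uvz expr1 mulN1r mulrN mulNr.
by rewrite (flow_antisym mu0 uv); ring.
Qed.

Lemma tree_dist_form mu : \sum_z mu z = 0 ->
  \sum_u \sum_z tree_dist u z * mu u * mu z =
    - \sum_u \sum_(v | adj T u v) weight T [set u; v] * flow mu u v ^+ 2.
Proof.
move=> mu0; pose g u := \sum_z tree_dist u z * mu z.
pose P := \sum_u \sum_(v | adj T u v) g u * flow mu u v.
have -> : \sum_u \sum_z tree_dist u z * mu u * mu z = - P.
  rewrite /P -sumrN; apply: eq_bigr => u _.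
  rewrite -mulr_sumr flow_divergence // mulrN opprK mulr_suml.
  by apply: eq_bigr => z _; rewrite mulrAC.
(* Each edge occurs in [P] in both directions, with opposite flows. *)
have PN : P = - \sum_u \sum_(v | adj T u v) g v * flow mu u v.
  rewrite /P (exchange_big_dep predT) //= -sumrN; apply: eq_bigr => v _.
  rewrite -sumrN (eq_bigl (adj T v)) => [|u]; last exact: adj_sym.
  by apply: eq_bigr => u vu; rewrite (flow_antisym mu0 vu) mulrN.
congr (- _); suff : P + P = 2 * \sum_u \sum_(v | adj T u v)
    weight T [set u; v] * flow mu u v ^+ 2 by lra.
rewrite {2}PN -sumrB mulr_sumr; apply: eq_bigr => u _.
rewrite -sumrB mulr_sumr; apply: eq_bigr => v uv.
by rewrite -mulrBl potential_drop //; ring.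
Qed.

Lemma sum_norm_le_flow mu : \sum_z mu z = 0 ->
  \sum_u `|mu u| <= \sum_u \sum_(v | adj T u v) `|flow mu u v|.
Proof.
move=> mu0; apply: ler_sum => u _.
by rewrite -normrN -flow_divergence // ler_norm_sum.
Qed.

(** Each edge is the unordered pair of exactly two directed edges, which are
    distinct as there are no loops. *)
Lemma sum_directed_edges (f : {set T} -> R) :
  \sum_u \sum_(v | adj T u v) f [set u; v] = 2 * \sum_(E in edges T) f E.
Proof.
rewrite pair_big_dep /=.
rewrite (partition_big (fun uv : T * T => [set uv.1; uv.2]) (mem (edges T))) /=; last first.
  by move=> uv a; apply/imsetP; exists uv; rewrite ?inE.
rewrite mulr_sumr; apply: eq_bigr => _ /imsetP[[a b] /= ab ->].
rewrite inE /= in ab.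
have nab : a != b by apply: contraTneq ab => ->; rewrite adj_irr.
rewrite (eq_bigr (fun=> f [set a; b])) => [|uv /andP[_ /eqP ->] //].
rewrite (eq_bigl (mem [set (a, b); (b, a)])) => [|[c d]] /=.
  by rewrite sumr_const cards2 xpair_eqE negb_and nab mulr_natl.
rewrite set2_eq // !inE andb_idl //.
by case/orP => /eqP[-> ->] //; rewrite adj_sym.
Qed.

(** The Cauchy-Schwarz step is done edge by edge: with [c] the optimal
    constant, [weight * (|flow| - c / weight) ^+ 2] is nonnegative.  As
    [Gamma ^+ 2 * Gamma^-1 = Gamma] also when [Gamma = 0], this form covers the
    tree without edges. *)
Lemma tree_dist_form_le mu : \sum_z mu z = 0 ->
  Gamma T / 2 * (\sum_z `|mu z|) ^+ 2
    + \sum_u \sum_z tree_dist u z * mu u * mu z <= 0.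
Proof.
move=> mu0; rewrite tree_dist_form // subr_le0.
set S := \sum_z `|mu z|; set Q := (X in _ <= X).
have G0 : 0 <= Gamma T.
  rewrite invr_ge0; apply: sumr_ge0 => _ /imsetP[[a b] /= ab ->].
  by rewrite inE /= in ab; rewrite invr_ge0 ltW // weight_gt0.
have S0 : 0 <= S by apply: sumr_ge0.
(* This value of [c] maximizes [2 * c * S - c ^+ 2 * (2 / Gamma T)], the lower
   bound that summing the squares over directed edges gives. *)
pose c := Gamma T * S / 2.
have c0 : 0 <= c by rewrite divr_ge0 // mulr_ge0.
set A := \sum_u \sum_(v | adj T u v) `|flow mu u v|.
have SA : S <= A by exact: sum_norm_le_flow.
have inv_sum : \sum_(E in edges T) (weight T E)^-1 = (Gamma T)^-1.
  by rewrite invrK.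
have QA : 2 * c * A - c ^+ 2 * (2 * (Gamma T)^-1) <= Q.
  rewrite -inv_sum -sum_directed_edges !mulr_sumr -sumrB; apply: ler_sum => u _.
  rewrite !mulr_sumr -sumrB; apply: ler_sum => v uv.
  have w0 := weight_gt0 uv; rewrite -subr_ge0.
  have /(mulr_ge0 (ltW w0)) := sqr_ge0 (`|flow mu u v| - c / weight T [set u; v]).
  rewrite -(real_normK (num_real (flow mu u v))).
  congr (_ <= _); field; exact: lt0r_neq0.
apply: le_trans QA; apply: (@le_trans _ _ (2 * c * S - c ^+ 2 * (2 * (Gamma T)^-1))).
  have GG : Gamma T ^+ 2 * (Gamma T)^-1 = Gamma T.
    have [->|nz] := eqVneq (Gamma T) 0; first by rewrite invr0 mulr0.
    by rewrite expr2 mulfK.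
  have -> : c ^+ 2 * (2 * (Gamma T)^-1) =
      Gamma T ^+ 2 * (Gamma T)^-1 * (S ^+ 2 / 2).
    by rewrite /c; move: (Gamma T)^-1 => Gi; field.
  by rewrite GG /c; lra.
by rewrite lerB // ler_wpM2l // mulr_ge0.
Qed.

End Flow.

(** Pushing the coefficients forward along [x] gives masses on the vertices;
    only the l1 norm needs injectivity, which rules out cancellation. *)
Theorem theorem4p16 (R : realType) (T : metricTree R) (n : nat) (hn : (2 <= n)%N)
    (x : 'I_n -> T) (hx : injective x)
    (eta : 'I_n -> R) (heta : \sum_(l < n) eta l = 0) :
  Gamma T / 2 * (\sum_(l < n) `|eta l|) ^+ 2
    + \sum_(i < n) \sum_(j < n) tree_dist (x i) (x j) * eta i * eta j <= 0.
Proof.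
pose mu z := \sum_(l | x l == z) eta l.
have push (h : T -> R) : \sum_l h (x l) * eta l = \sum_z h z * mu z.
  rewrite (partition_big x predT) //=; apply: eq_bigr => z _.
  by rewrite mulr_sumr; apply: eq_bigr => l /eqP ->.
have mu0 : \sum_z mu z = 0.
  by apply: etrans heta; rewrite [RHS](partition_big x predT).
have norm_push : \sum_l `|eta l| = \sum_z `|mu z|.
  rewrite (partition_big x predT) //=; apply: eq_bigr => z _; rewrite /mu.
  have [l /eqP <-|noz] := pickP (fun l => x l == z); last by rewrite !big_pred0 ?normr0.
  by rewrite !(big_pred1 l) // => k; rewrite /= (inj_eq hx).
have form_push : \sum_i \sum_j tree_dist (x i) (x j) * eta i * eta j =
    \sum_u \sum_z tree_dist u z * mu u * mu z.
  pose g u := \sum_z tree_dist u z * mu z.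
  transitivity (\sum_i g (x i) * eta i).
    apply: eq_bigr => i _; rewrite /g -push mulr_suml.
    by apply: eq_bigr => j _; rewrite mulrAC.
  rewrite push; apply: eq_bigr => u _; rewrite mulr_suml.
  by apply: eq_bigr => z _; rewrite mulrAC.
by rewrite norm_push form_push; exact: tree_dist_form_le.
Qed.
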